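(* Let $k,m\ge 1$ and let $X(n)=(X_1(n),X_2(n))$, $n=0,1,2,\ldots$, be a (time-homogeneous, discrete-time) Markov chain on the countable state space $\mathbb{Z}_+^k\times\mathbb{Z}_+^m$, with $X_1(n)=(X_{11}(n),\ldots,X_{1k}(n))\in\mathbb{Z}_+^k$ and $X_2(n)=(X_{21}(n),\ldots,X_{2m}(n))\in\mathbb{Z}_+^m$. Assume the following: 1. $\lim_{n\to\infty}X_{2i}(n)=\infty$ almost surely, for all $i=1,\ldots,m$ and for any initial condition $(X_1(0),X_2(0))$. 2. There are transition probabilities $P_{i,j}$, $i,j\in\mathbb{Z}_+^k$, of an ergodic Markov chain with unique stationary distribution $\pi=\{\pi_j\}_{j\in\mathbb{Z}_+^k}$, such that $$\mathbf{P}\big(X_1(n+1)=j\,\big|\,X_1(n)=i,\;X_2(n)=l\big)=P_{i,j}$$ for all $i,j\in\mathbb{Z}_+^k$ and all $l=(l_1,\ldots,l_m)\in\mathbb{Z}_+^m$ with all coordinates strictly positive. Then for all initial $i_0\in\mathbb{Z}_+^k$, $j_0\in\mathbb{Z}_+^m$: $$\sup_{j\in\mathbb{Z}_+^k}\Big|\mathbf{P}\big(X_1(n)=j\,\big|\,X_1(0)=i_0,\,X_2(0)=j_0\big)-\pi_j\Big|\to 0\quad\text{as } n\to\infty,$$ i.e. the distribution of $X_1(n)$ converges to $\pi$ in the total variation norm.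
   Context: $\mathbb{Z}_+=\{0,1,2,\ldots\}$. Conditional probabilities of the form $\mathbf{P}(X_1(n+1)=j\mid X_1(n)=i,X_2(n)=l)$ are understood as one-step transition probabilities of the chain $X$ from the state $(i,l)$, i.e. the sum over $l'\in\mathbb{Z}_+^m$ of the one-step transition probabilities from $(i,l)$ to $(j,l')$. A Markov chain on a countable state space with transition probabilities $P_{i,j}$ is called ergodic if it has a unique stationary distribution $\pi$ and, from every initial state, its distribution at time $n$ converges to $\pi$ as $n\to\infty$ (for instance, an irreducible, aperiodic, positive recurrent chain). The processes $X_1$ and $X_2$ need not be Markov chains on their own. *)

(* Defs.v *)
From HB Require Import structures.
From mathcomp Require Import all_boot all_order all_algebra.
From mathcomp Require Import all_classical all_reals all_analysis.
Set Implicit Arguments.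
Unset Strict Implicit.
Unset Printing Implicit Defensive.
Import Order.TTheory GRing.Theory Num.Theory.
Import numFieldNormedType.Exports.
Local Open Scope classical_set_scope.
Local Open Scope ring_scope.

Section transition_probabilities.
Context {R : realType} {S : choiceType}.
Implicit Types (p : S -> S -> R) (mu pi : S -> R).

Definition is_distr mu :=
  (forall x, 0 <= mu x) /\ (\esum_(x in [set: S]) (mu x)%:E = 1)%E.

Definition transition_matrix p := forall x, is_distr (p x).

Definition stationary p mu :=
  is_distr mu /\
  forall y, (\esum_(x in [set: S]) (mu x * p x y)%:E = (mu y)%:E)%E.

(* [nstep p n x] is the law at time [n] of the chain started at [x]. *)
Fixpoint nstep p (n : nat) (x y : S) : \bar R :=
  if n is n'.+1
  then (\esum_(z in [set: S]) (nstep p n' x z * (p z y)%:E))%E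
  else ((x == y)%:R)%:E.

(* Convergence in law on a discrete countable space is pointwise convergence
   of the point masses. *)
Definition ergodic p pi :=
  [/\ transition_matrix p,
      stationary p pi,
      forall mu, stationary p mu -> mu = pi
    & forall x y, nstep p n x y @[n --> \oo] --> (pi y)%:E].

End transition_probabilities.

Section markov_chain.
Context {R : realType} {d : measure_display} {T : measurableType d}.

(* Only meaningful when [P B != 0]. *)
Definition cond_prob (P : probability T R) (A B : set T) : R :=
  fine (P (A `&` B)) / fine (P B).

Context {S : choiceType}.

Definition history (X : nat -> T -> S) (n : nat) (s : nat -> S) : set T :=
  [set w | forall t, (t <= n)%N -> X t w = s t].

Definition markov_chain (P : probability T R) (p : S -> S -> R)
    (X : nat -> T -> S) :=
  forall n (s : nat -> S) (y : S),
    P (history X n s) != 0%E ->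
    cond_prob P [set w | X n.+1 w = y] (history X n s) = p (s n) y.

(* [Px x] is the law under which the chain starts at [x]: probabilities
   conditional on the initial state [x] are probabilities under [Px x]. *)
Definition markov_family (Px : S -> probability T R) (p : S -> S -> R)
    (X : nat -> T -> S) :=
  transition_matrix p /\
  forall x, Px x [set w | X 0%N w = x] = 1%E /\ markov_chain (Px x) p X.

End markov_chain.

(* Main.v *)
Require Import Defs.
From HB Require Import structures.
From mathcomp Require Import all_boot all_order all_algebra.
From mathcomp Require Import all_classical all_reals all_analysis.
From mathcomp Require Import lra.
Import Order.TTheory GRing.Theory Num.Theory.
Import numFieldNormedType.Exports.
Local Open Scope classical_set_scope.
Local Open Scope ring_scope.

(** Let [G] be the set of second components with all coordinates positive.  As
    long as [X2] stays in [G], the first component moves exactly like the chain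
    with matrix [P], and since [X2] diverges it almost surely stays in [G] from
    some time on.  That time is random and not a stopping time, so one cannot
    restart the chain there; and the one-step errors between the law of [X1]
    and the [P]-chain need not be summable.  The proof goes around both points
    as follows.

    Fix a deterministic time [N] so large that [X2] leaves [G] after [N] with
    probability at most [e].  For an event [D] known at time [N] on which
    [X1 N = i], consider the sub-probability
      [c n j = Pr (D, X2 in G on [N, N + n), X1 (N + n) = j)].
    The Markov property gives [c n.+1 j <= \sum_z c n z * P z j]; hence [c n j]
    is at most [Pr D * nstep P n i j] ([stay_nstep_le]).  Both sides are
    nonnegative functions of [j], of total mass [Pr (D, X2 in G on [N, N + n))]
    and [Pr D], so that their difference at any single [j] is at most the
    difference of these masses, the probability of leaving [G].  This reverses
    the inequality up to an error ([nstep_le_marginal]).  Summing over finitely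
    many [i] that carry most of the law of [X1 N], letting [n] tend to infinity
    in the finite sum, and then [e] to zero, yields
      [pi j <= liminf_n Pr (X1 n = j)]   ([liminf_marginal_ge]).

    A pointwise lower bound of this kind between probability laws is enough for
    convergence in total variation ([scheffe]): no mass is left for these
    laws to stay above [pi] anywhere.  The supremum over [j] is bounded by the sum
    over [j], so the first limit follows from the second. *)

(** * Sums over arbitrary index types *)

Section esum_complements.
Context {R : realType} {I : choiceType}.
Implicit Types (a : I -> \bar R).
Local Open Scope ereal_scope.

Lemma ge0_esumZl a (c : R) : (0 <= c)%R -> (forall i, 0 <= a i) ->
  \esum_(i in [set: I]) (c%:E * a i) = c%:E * \esum_(i in [set: I]) a i.
Proof.
move=> c0 a0; rewrite /esum -ereal_supZl//; last first.
  by apply/set0P; eexists; exists set0; [exact: fsets_set0|reflexivity].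
rewrite image_comp; congr ereal_sup; apply: eq_imagel => F [finF _] /=.
by rewrite ge0_mule_fsumr.
Qed.

Lemma lee_uniq_sum_esum a (s : seq I) : (forall i, 0 <= a i) -> uniq s ->
  \sum_(i <- s) a i <= \esum_(i in [set: I]) a i.
Proof.
move=> a0 us; apply: esum_ge; exists [set` s]; first by split.
by rewrite fsbig_seq.
Qed.

Lemma lt_esum_uniq_sum a (x : \bar R) : x < \esum_(i in [set: I]) a i ->
  exists2 s : seq I, uniq s & x < \sum_(i <- s) a i.
Proof.
move=> /ereal_sup_gt[_ [F [finF _] <-]] xF.
exists (finmap.enum_fset (fset_set F)); rewrite ?finmap.fset_uniq//.
by rewrite -fsbig_finite.
Qed.

End esum_complements.

Lemma ge0_exchange_esum {R : realType} {I J : choiceType}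
    (a : I -> J -> \bar R) :
  (forall i j, 0 <= a i j)%E ->
  \esum_(i in [set: I]) \esum_(j in [set: J]) a i j =
  \esum_(j in [set: J]) \esum_(i in [set: I]) a i j.
Proof.
move=> a0; rewrite [LHS]esum_esum// [RHS]esum_esum//.
rewrite (reindex_esum ([set: J] `*`` fun=> [set: I]) _ (fun z => (z.2, z.1)))//.
by split=> [//|[? ?] [? ?] _ _ [-> ->]//|[i j] _]; exists (j, i).
Qed.

(** * Events read off a countably valued map *)

Section countable_valued.
Context {R : realType} {d : measure_display} {T : measurableType d}.
Context {I : countType}.
Variables (Pr : probability T R) (f : T -> I).
Hypothesis mf : forall i, measurable [set w | f w = i].
Local Open Scope ereal_scope.

Lemma measurable_countable_preimage (A : set I) : measurable (f @^-1` A).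
Proof.
rewrite (_ : _ @^-1` _ = \bigcup_(i in A) [set w | f w = i]).
  rewrite bigcup_mkcond.
  apply: countable_bigcupT_measurable; first exact: countableP.
  by move=> i; case: ifP.
by apply/seteqP; split=> [w Afw|w [i Ai /= fw]] /=; [exists (f w)|rewrite fw].
Qed.

Lemma measure_partition (B : set T) : measurable B ->
  Pr B = \esum_(i in [set: I]) Pr (B `&` [set w | f w = i]).
Proof.
move=> mB; pose F n := B `&` [set w | pickle (f w) = n].
rewrite (_ : B = \bigcup_(n in range (@pickle I)) F n); last first.
  apply/seteqP; split=> [w Bw|w [n _ []]]//.
  by exists (pickle (f w)) => //; exists (f w).
rewrite measure_bigcup; last 2 first.
- move=> n [i _ <-]; apply: measurableI => //.
  by apply: (measurable_countable_preimage [set j | pickle j = pickle i]).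
- apply/trivIsetP => i j _ _ /eqP ij; apply/seteqP; split=> //.
  by move=> w [[_ /= fi] [_ /= fj]]; case: ij; rewrite -fi.
rewrite nneseries_esum// set_mem_set esum_image; last first.
  by move=> i j _ _; exact: (pcan_inj pickleK).
apply: eq_esum => i _; congr (Pr _); apply/seteqP; split=> w [Bw /= fw].
  split; last exact: (pcan_inj pickleK).
  by exists (pickle (f w)) => //; exists (f w).
by case: Bw => n _ [Bw _]; rewrite /F /= fw.
Qed.

Lemma sum_partition_le (B : set T) (s : seq I) : measurable B -> uniq s ->
  \sum_(i <- s) Pr (B `&` [set w | f w = i]) <= Pr B.
Proof.
move=> mB us; rewrite (measure_partition B mB).
exact: lee_uniq_sum_esum.
Qed.

End countable_valued.

(** * Events of the past and the Markov property *)

Section past_events.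
Context {T : Type} {S : Type}.
Implicit Types (X : nat -> T -> S) (C : set T).

(** Measurability with respect to the sigma-algebra generated by
    [X 0, ..., X n], phrased through its atoms: for a countable state space an
    event belongs to it exactly when it is saturated for these variables. *)
Definition past_event X n C := forall w w' : T,
  (forall t, (t <= n)%N -> X t w = X t w') -> C w -> C w'.

(** The past is packed in a [seq S] because this type is again countable when
    [S] is, so that events can be split along its values. *)
Definition past X n (w : T) : seq S := mkseq (X ^~ w) n.+1.

Lemma pastP X n w w' :
  past X n w = past X n w' <-> forall t, (t <= n)%N -> X t w = X t w'.
Proof.
split=> [e t tn|e]; last by apply/eq_in_map => t; rewrite mem_iota /= => /e.
have := congr1 (fun u => nth (X 0%N w) u t) e.
by rewrite !nth_mkseq.
Qed.

Lemma past_eventI X n C D :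
  past_event X n C -> past_event X n D -> past_event X n (C `&` D).
Proof. by move=> pC pD w w' e [/(pC _ _ e) ? /(pD _ _ e)]. Qed.

Lemma past_eventW X n n' C : (n <= n')%N ->
  past_event X n C -> past_event X n' C.
Proof.
by move=> nn' pC w w' e; apply: pC => t tn; apply: e; exact: leq_trans nn'.
Qed.

Lemma past_event_preimage X n t (A : set S) : (t <= n)%N ->
  past_event X n (X t @^-1` A).
Proof. by move=> tn w w' e; rewrite /preimage /= (e _ tn). Qed.

End past_events.

Section markov_step.
Context {R : realType} {d : measure_display} {T : measurableType d}.
Context {S : countType}.
Variables (Pr : probability T R) (p : S -> S -> R) (X : nat -> T -> S).
Hypothesis mX : forall n x, measurable [set w | X n w = x].
Hypothesis p_ge0 : forall x y, 0 <= p x y.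
Hypothesis X_markov : markov_chain Pr p X.

Lemma measurable_history n s : measurable (history X n s).
Proof.
rewrite (_ : history X n s = \bigcap_(t in `I_n.+1) [set w | X t w = s t]) //.
by apply: fin_bigcap_measurable => // t _; exact: mX.
Qed.

Lemma past_fiber n w : [set w' | past X n w' = past X n w] =
  history X n (X ^~ w).
Proof.
by apply/seteqP; split=> w' /=; [move/pastP|move=> e; apply/pastP].
Qed.

Lemma measurable_past n u : measurable [set w | past X n w = u].
Proof.
have [[w _ <-]|nu] := pselect (range (past X n) u).
  by rewrite past_fiber; exact: measurable_history.
rewrite (_ : [set _ | _] = set0)//; apply/seteqP; split=> // w wu.
by apply: nu; exists w.
Qed.

Lemma measurable_past_event n C : past_event X n C -> measurable C.
Proof.
move=> pC; rewrite (_ : C = past X n @^-1` (past X n @` C)).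
  exact/measurable_countable_preimage/measurable_past.
apply/seteqP; split=> [w Cw|w [w' Cw' /pastP e]]; first by exists w.
exact: pC e Cw'.
Qed.

Local Open Scope ereal_scope.

Lemma markov_history n s y :
  Pr (history X n s `&` [set w | X n.+1 w = y]) =
  Pr (history X n s) * (p (s n) y)%:E.
Proof.
have mH := measurable_history n s.
have mHy : measurable (history X n s `&` [set w | X n.+1 w = y]).
  exact: measurableI.
have [H0|Hn0] := eqVneq (Pr (history X n s)) 0.
  rewrite H0 mul0e; apply/eqP; rewrite -measure_le0 -H0.
  by apply: le_measure; rewrite ?inE//; exact: subIsetl.
have Hf : fine (Pr (history X n s)) != 0%R.
  by rewrite fine_eq0// fin_num_measure.
rewrite -(X_markov _ _ _ Hn0) /cond_prob setIC.
rewrite -[X in _ = X * _]fineK ?fin_num_measure// -EFinM mulrC divfK//.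
by rewrite fineK// fin_num_measure// setIC.
Qed.

(** The defining property of [markov_chain] speaks of single trajectories; an
    event of the past is a countable disjoint union of those, and the factor
    [p x y] is common to all of them because they all end at [x]. *)
Lemma markov_past_event n C x y : past_event X n C ->
  C `<=` [set w | X n w = x] ->
  Pr (C `&` [set w | X n.+1 w = y]) = Pr C * (p x y)%:E.
Proof.
move=> pC Cx; have mC := measurable_past_event _ _ pC.
rewrite (measure_partition Pr _ (measurable_past n) (C `&` _)); last first.
  exact: measurableI.
rewrite (measure_partition Pr _ (measurable_past n) C)// muleC -ge0_esumZl//.
apply: eq_esum => u _; rewrite muleC.
have [[w [Cw <-]]|nu] := pselect (exists w, C w /\ past X n w = u).
  have Cfib : C `&` [set w' | past X n w' = past X n w] = history X n (X ^~ w).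
    rewrite past_fiber setIidr// => w' e; apply: pC Cw => t tn.
    by rewrite e.
  rewrite setIAC Cfib.
  by rewrite markov_history (Cx _ Cw).
have C0 : C `&` [set w | past X n w = u] = set0.
  by apply/seteqP; split=> // w [Cw wu]; apply: nu; exists w.
by rewrite setIAC C0 set0I measure0 mul0e.
Qed.
End markov_step.

(** * Comparison with the limiting chain *)

Section nstep_facts.
Context {R : realType} {S : choiceType}.
Variable p : S -> S -> R.
Hypothesis pT : transition_matrix p.
Local Open Scope ereal_scope.

Lemma transition_matrix_ge0 x y : (0 <= p x y)%R.
Proof. by have [] := pT x. Qed.

Lemma nstep_ge0 n x y : 0 <= nstep p n x y.
Proof.
elim: n y => [|n IH] y /=; first by rewrite lee_fin.
by apply: esum_ge0 => z _; rewrite mule_ge0// lee_fin transition_matrix_ge0.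
Qed.

Lemma nstep_mass n x : \esum_(y in [set: S]) nstep p n x y = 1.
Proof.
elim: n => [|n IH] /=.
  rewrite (esumID [set x])//.
  rewrite setTI esum_set1// eqxx esum1 ?adde0// => y [_ /= /eqP].
  by rewrite eq_sym => /negPf ->.
rewrite ge0_exchange_esum; last first.
  by move=> i j; rewrite mule_ge0 ?nstep_ge0// lee_fin transition_matrix_ge0.
rewrite -[RHS]IH; apply: eq_esum => z _.
(* [nstep] is extended-real valued, but scaling a sum needs a real factor *)
have : nstep p n x z <= 1.
  rewrite -IH (esumID [set z])//; last by move=> i _; exact: nstep_ge0.
  rewrite setTI esum_set1 ?nstep_ge0// leeDl// esum_ge0// => i _.
  exact: nstep_ge0.
have := nstep_ge0 n x z.
case: (nstep p n x z) => // r; rewrite lee_fin => r0 _.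
rewrite ge0_esumZl//; last by move=> y; rewrite lee_fin transition_matrix_ge0.
by have [_ ->] := pT z; rewrite mule1.
Qed.

End nstep_facts.

Section comparison.
Context {R : realType} {d : measure_display} {T : measurableType d}.
Context {S1 S2 : countType}.
Variables (Pr : probability T R) (p : S1 * S2 -> S1 * S2 -> R).
Variables (X : nat -> T -> S1 * S2) (P : S1 -> S1 -> R) (G : set S2).
Hypothesis mX : forall n x, measurable [set w | X n w = x].
Hypothesis pT : transition_matrix p.
Hypothesis X_markov : markov_chain Pr p X.
Hypothesis PT : transition_matrix P.
Hypothesis X1_trans : forall i j l, G l ->
  (\esum_(l' in [set: S2]) (p (i, l) (j, l'))%:E = (P i j)%:E)%E.
Local Open Scope ereal_scope.

Lemma measurable_state n (A : set (S1 * S2)) : measurable (X n @^-1` A).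
Proof. exact: measurable_countable_preimage. Qed.

Lemma measurable_fst_state n j : measurable [set w | (X n w).1 = j].
Proof. exact: (measurable_state n [set x | x.1 = j]). Qed.

Lemma measurable_snd_state n l : measurable [set w | (X n w).2 = l].
Proof. exact: (measurable_state n [set x | x.2 = l]). Qed.

(** Inside [G] the next value of the first component does not depend on the
    second one: after splitting along the values of [X2] at times [n] and
    [n.+1], the inner sum is that of [X1_trans]. *)
Lemma marginal_markov_step n C z j : past_event X n C ->
  C `<=` [set w | (X n w).1 = z /\ G (X n w).2] ->
  Pr (C `&` [set w | (X n.+1 w).1 = j]) = Pr C * (P z j)%:E.
Proof.
move=> pC CG.
have mC : measurable C by exact: measurable_past_event mX _ _ pC.
have p_ge0 := transition_matrix_ge0 _ pT.
rewrite [LHS](measure_partition Pr _ (measurable_snd_state n)); last first.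
  by apply: measurableI => //; exact: measurable_fst_state.
rewrite (measure_partition Pr _ (measurable_snd_state n) C)// muleC.
rewrite -ge0_esumZl//; last first.
  exact: transition_matrix_ge0.
apply: eq_esum => l _; rewrite setIAC.
have [Gl|nGl] := pselect (G l); last first.
  suff -> : C `&` [set w | (X n w).2 = l] = set0.
    by rewrite set0I measure0 mule0.
  by apply/seteqP; split=> // w [/CG[_ +] wl]; rewrite wl.
have pCl : past_event X n (C `&` [set w | (X n w).2 = l]).
  apply: past_eventI => //.
  exact: (past_event_preimage X n n [set x | x.2 = l]).
have mCl := measurable_past_event X mX _ _ pCl.
rewrite [LHS](measure_partition Pr _ (measurable_snd_state n.+1)); last first.
  by apply: measurableI => //; exact: measurable_fst_state.
rewrite -(X1_trans z j l Gl) [RHS]muleC.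
rewrite -[Pr (C `&` [set w | (X n w).2 = l])]fineK ?fin_num_measure//.
rewrite -ge0_esumZl ?fine_ge0//; last by move=> ?; rewrite lee_fin.
apply: eq_esum => l' _; rewrite fineK ?fin_num_measure//.
rewrite -(markov_past_event Pr p X mX p_ge0 X_markov n)//; last first.
  by move=> w [/CG[]]/=; case: (X n w) => /= ? ? -> _ ->.
congr (Pr _); rewrite -setIA; congr (_ `&` _).
by apply/seteqP; split=> w /=; [case: (X n.+1 w) => /= ? ? [-> ->]|move=> ->].
Qed.

(** The interval excludes [N + n], so that the second component is in [G] before
    each of the [n] steps from [N] to [N + n]. *)
Definition stay N n := [set w | forall t, (N <= t < N + n)%N -> G (X t w).2].

Lemma past_event_stay N n n' : (N + n <= n'.+1)%N -> past_event X n' (stay N n).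
Proof.
move=> h w w' e Gw t /andP[Nt tn]; rewrite -e; first by apply: Gw; rewrite Nt.
by rewrite -ltnS (leq_trans tn).
Qed.

Lemma measurable_stay N n : measurable (stay N n).
Proof.
apply: (measurable_past_event X mX (N + n)%N).
exact: past_event_stay.
Qed.

(** Only an inequality survives the induction: the condition [X2 in G] at the
    current time is used to make a step of [P] and then dropped. *)
Lemma stay_nstep_le N i D n j : past_event X N D ->
  D `<=` [set w | (X N w).1 = i] ->
  Pr (D `&` stay N n `&` [set w | (X (N + n) w).1 = j]) <=
  Pr D * nstep P n i j.
Proof.
move=> pD Di; have mD : measurable D by exact: measurable_past_event mX _ _ pD.
elim: n j => [|n IH] j.
  rewrite addn0 /=; have [<-|ij] := eqVneq i j.
    rewrite mule1 le_measure ?inE//; last by move=> w [[]].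
    apply: measurableI; last exact: measurable_fst_state.
    by apply: measurableI => //; exact: measurable_stay.
  rewrite mule0 (_ : _ `&` _ = set0) ?measure0//.
  by apply/seteqP; split=> // w [[/Di /= -> _]] /= /eqP; rewrite (negPf ij).
have mDs : measurable (D `&` stay N n.+1).
  by apply: measurableI => //; exact: measurable_stay.
rewrite (measure_partition Pr _ (measurable_fst_state (N + n))); last first.
  by apply: measurableI => //; exact: measurable_fst_state.
rewrite -[Pr D]fineK ?fin_num_measure//= -ge0_esumZl ?fine_ge0//; last first.
  by move=> z; rewrite mule_ge0 ?nstep_ge0// lee_fin transition_matrix_ge0.
apply: le_esum => z _; rewrite setIAC addnS.
rewrite (marginal_markov_step _ _ z); last 2 first.
- apply: past_eventI.
    apply: past_eventI; last by apply: past_event_stay; rewrite addnS.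
    by apply: past_eventW pD; rewrite leq_addr.
  exact: (past_event_preimage X _ _ [set x | x.1 = z]).
- move=> w [[_ Gw] /= ->]; split=> //; apply: Gw.
  by rewrite leq_addr addnS ltnSn.
rewrite muleA; apply: lee_wpmul2r.
  by rewrite lee_fin transition_matrix_ge0.
rewrite fineK ?fin_num_measure//; apply: le_trans (IH z).
rewrite le_measure ?inE//.
- by apply: measurableI => //; exact: measurable_fst_state.
- apply: measurableI; last exact: measurable_fst_state.
  by apply: measurableI => //; exact: measurable_stay.
move=> w [[Dw Gw] wz]; split=> //; split=> // t /andP[Nt tn].
by apply: Gw; rewrite Nt addnS ltnS ltnW.
Qed.

(** A pointwise inequality [c <= a] between nonnegative families can be reversed
    at the cost of the difference of their total masses.  Here [a], the [P]-chain
    started from [D], has mass [Pr D], and [c], which forgets the trajectories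
    that left [G], has mass [Pr (D `&` stay N n)]. *)
Lemma nstep_le_marginal N i D n j : past_event X N D ->
  D `<=` [set w | (X N w).1 = i] ->
  Pr D * nstep P n i j <=
  Pr (D `&` [set w | (X (N + n) w).1 = j]) + Pr (D `\` stay N n).
Proof.
move=> pD Di; have mD : measurable D by exact: measurable_past_event mX _ _ pD.
have mE : measurable (D `&` stay N n).
  by apply: measurableI => //; exact: measurable_stay.
set E := D `&` stay N n in mE *.
pose a j := Pr D * nstep P n i j.
pose c j := Pr (E `&` [set w | (X (N + n) w).1 = j]).
have mEj j' : measurable (E `&` [set w | (X (N + n) w).1 = j']).
  by apply: measurableI => //; exact: measurable_fst_state.
have ac j' : c j' <= a j' by exact: stay_nstep_le.
have c0 j' : 0 <= c j' by [].
have a0 j' : 0 <= a j' by exact: le_trans (ac j').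
have sa : \esum_(j in [set: S1]) a j = Pr D.
  rewrite /a -[Pr D]fineK ?fin_num_measure// ge0_esumZl ?fine_ge0//.
    by rewrite (nstep_mass _ PT) mule1.
  by move=> ?; exact: nstep_ge0.
have sc : \esum_(j in [set: S1]) c j = Pr E.
  by rewrite (measure_partition Pr _ (measurable_fst_state (N + n)) E).
have DE : Pr D = Pr E + Pr (D `\` stay N n).
  by rewrite addeC; apply: measureDI => //; exact: measurable_stay.
(* split off the term at [j] in both sums; the other terms compare by [ac] *)
have : \esum_(j in ~` [set j]) c j <= \esum_(j in ~` [set j]) a j.
  by apply: le_esum => *; exact: ac.
move: sa sc; rewrite !(esumID [set j] setT)// !setTI !esum_set1// => sa sc ca.
have aj : a j \is a fin_num.
  rewrite ge0_fin_numE// (@le_lt_trans _ _ (Pr D))//; last first.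
    by rewrite ltey_eq fin_num_measure.
  by rewrite -sa leeDl// esum_ge0.
have cj : c j \is a fin_num by rewrite fin_num_measure.
apply: (@le_trans _ _ (c j + Pr (D `\` stay N n))); last first.
  apply: leeD => //; apply: le_measure; rewrite ?inE//.
    by apply: measurableI => //; exact: measurable_fst_state.
  by move=> w [[Dw _] ?].
rewrite -/(a j).
have fE : Pr E \is a fin_num by rewrite fin_num_measure.
rewrite -(leeD2rE _ _ fE) -[leRHS]addeA [X in _ <= _ + X]addeC -DE -sa -sc.
by rewrite addeCA leeD2lE// leeD2lE.
Qed.

End comparison.

(** * From pointwise lower bounds to total variation *)

Section ereal_limits.
Context {R : realType}.
Implicit Type u : nat -> \bar R.
Local Open Scope ereal_scope.

Lemma cvge_near_ge u (a e : R) : u n @[n --> \oo] --> a%:E -> (0 < e)%R ->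
  \forall n \near \oo, (a - e)%:E <= u n.
Proof.
move=> /fine_cvgP[uf /cvgrPdist_le ua] e0; near=> n.
have un : u n \is a fin_num by near: n.
have : (`|a - fine (u n)| <= e)%R by near: n; exact: ua.
rewrite ler_norml => /andP[_ ae].
by rewrite -(fineK un) lee_fin lerBlDr -lerBlDl.
Unshelve. all: end_near. Qed.

Lemma ge0_cvge0 u : (forall n, 0 <= u n) ->
  (forall e : R, (0 < e)%R -> \forall n \near \oo, u n <= e%:E) ->
  u n @[n --> \oo] --> 0.
Proof.
move=> u0 ue; have uf e n : u n <= e%:E -> u n \is a fin_num.
  by move=> une; rewrite ge0_fin_numE// (le_lt_trans une)// ltry.
apply/fine_cvgP; split.
  near=> n; apply: (uf 1%R); near: n; exact: ue.
apply/cvgrPdist_le => e e0; near=> n.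
have une : u n <= e%:E by near: n; exact: ue.
rewrite sub0r normrN ger0_norm ?fine_ge0//.
by rewrite -lee_fin fineK// (uf e).
Unshelve. all: end_near. Qed.

End ereal_limits.

Section scheffe.
Context {R : realType} {S : choiceType}.
Local Open Scope ereal_scope.

Lemma esum_if_seq (a : S -> \bar R) (s : seq S) :
  (forall i, 0 <= a i) -> uniq s ->
  \esum_(i in [set: S]) (if i \in s then a i else 0) = \sum_(i <- s) a i.
Proof.
move=> a0 us; transitivity (\esum_(i in [set` s]) a i).
  rewrite [RHS]esum_mkcond; apply: eq_esum => i _.
  by congr (if _ then _ else _); apply/idP/idP; rewrite inE.
by rewrite esum_fset// [RHS]fsbig_seq.
Qed.

Lemma is_distr_le1 (mu : S -> R) j : is_distr mu -> (mu j <= 1)%R.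
Proof.
move=> [mu0 mu1]; rewrite -lee_fin -mu1.
have := @lee_uniq_sum_esum _ _ (fun i => (mu i)%:E) [:: j].
by rewrite big_seq1; apply.
Qed.

(** If [mu] is almost above [pi] on [s] and [s] carries most of [pi], then little
    mass of either law is left outside [s].  Pointwise, [`|mu - pi| + 2 pi] is
    at most [mu + pi + 2 delta] on [s], while [`|mu - pi| <= mu + pi]
    elsewhere; the statement is the sum of these bounds. *)
Lemma l1_dist_le (mu pi : S -> R) (s : seq S) (delta : R) :
  is_distr mu -> is_distr pi -> uniq s ->
  (forall j, j \in s -> pi j <= mu j + delta)%R -> (0 <= delta)%R ->
  \esum_(j in [set: S]) `|(mu j - pi j)%R|%:E +
    2%:E * \sum_(j <- s) (pi j)%:E <= (2 + 2 * delta *+ size s)%:E.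
Proof.
move=> [mu0 mu1] [pi0 pi1] us le_pi d0.
rewrite [leRHS]EFinD.
rewrite (_ : (2 * delta *+ size s)%:E = \sum_(j <- s) (2 * delta)%:E);
  last first.
  by rewrite sumEFin big_const_seq count_predT iter_addr_0.
rewrite ge0_sume_distrr; last by move=> j _; rewrite lee_fin.
rewrite -!esum_if_seq//; last 2 first.
- by move=> j; rewrite lee_fin mulr_ge0.
- by move=> j; rewrite lee_fin mulr_ge0.
rewrite [X in _ <= X + _](_ : _ =
    \esum_(j in [set: S]) ((mu j)%:E + (pi j)%:E)); last first.
  rewrite esumD => [|j _|j _]; [by rewrite mu1 pi1|by rewrite lee_fin..].
rewrite -!esumD; first last.
- by move=> j _; case: ifP => // _; rewrite lee_fin mulr_ge0.
- by move=> j _; rewrite lee_fin.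
- by move=> j _; case: ifP => // _; rewrite lee_fin mulr_ge0.
- by move=> j _; rewrite -EFinD lee_fin addr_ge0.
apply: le_esum => j _; have := mu0 j; have := pi0 j.
case: ifP => [/le_pi|_]; rewrite -!EFinD lee_fin.
  by move=> ? ? ?; have [?|?] := ger0P (mu j - pi j); lra.
by move=> ? ?; have [?|?] := ger0P (mu j - pi j); lra.
Qed.

(** Scheffe's lemma for discrete laws, from a lower bound on the inferior limits
    of the point masses; the matching upper bound is forced by total mass one. *)
Lemma scheffe (mu : nat -> S -> R) (pi : S -> R) :
  (forall n, is_distr (mu n)) -> is_distr pi ->
  (forall j (e : R), (0 < e)%R ->
    \forall n \near \oo, (pi j <= mu n j + e)%R) ->
  \esum_(j in [set: S]) `|(mu n j - pi j)%R|%:E @[n --> \oo] --> 0.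
Proof.
move=> dmu dpi le_pi; apply: ge0_cvge0 => [n|e e0].
  by apply: esum_ge0 => j _; rewrite lee_fin.
have [s us pis] : exists2 s : seq S, uniq s &
    (1 - e / 4)%:E < \sum_(j <- s) (pi j)%:E.
  by apply: lt_esum_uniq_sum; rewrite dpi.2 lte_fin; lra.
(* [.+1] keeps the denominator positive when [s] is empty *)
pose delta := (e / 4 / (size s).+1%:R)%R.
have d0 : (0 < delta)%R by rewrite !divr_gt0.
have ds : (delta *+ size s <= e / 4)%R.
  rewrite -mulr_natr mulrAC ler_pdivrMr// ler_wpM2l ?ler_nat//.
  by rewrite divr_ge0 ?ltW.
near=> n.
have le_s j : j \in s -> (pi j <= mu n j + delta)%R.
  move=> js.
  have : forall x : seq_sub s, (pi (val x) <= mu n (val x) + delta)%R.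
    by near: n; apply: filter_forall => x; exact: le_pi.
  by move=> /(_ (SeqSub js)).
have := l1_dist_le _ _ _ _ (dmu n) dpi us le_s (ltW d0).
move: pis; rewrite sumEFin lte_fin => pis.
have L0 : 0 <= \esum_(j in [set: S]) `|(mu n j - pi j)%R|%:E.
  by apply: esum_ge0 => j _; rewrite lee_fin.
move: L0; case: (esum _ _) => [r| |]//=.
rewrite -EFinM -EFinD !lee_fin -mulrnAr => _ ?; lra.
Unshelve. all: end_near. Qed.

End scheffe.

(** * Convergence of the first component *)

Section convergence.
Context {R : realType} {d : measure_display} {T : measurableType d}.
Context {S1 S2 : countType}.
Variables (Pr : probability T R) (p : S1 * S2 -> S1 * S2 -> R).
Variables (X : nat -> T -> S1 * S2) (P : S1 -> S1 -> R) (G : set S2).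
Variable pi : S1 -> R.
Hypothesis mX : forall n x, measurable [set w | X n w = x].
Hypothesis pT : transition_matrix p.
Hypothesis X_markov : markov_chain Pr p X.
Hypothesis P_ergodic : ergodic P pi.
Hypothesis X1_trans : forall i j l, G l ->
  (\esum_(l' in [set: S2]) (p (i, l) (j, l'))%:E = (P i j)%:E)%E.
Hypothesis X2_good : {ae Pr, forall w, \forall t \near \oo, G (X t w).2}.
Local Open Scope ereal_scope.

Let always_good N := [set w | forall t, (N <= t)%N -> G (X t w).2].

Let measurable_always_good N : measurable (always_good N).
Proof.
rewrite (_ : always_good N =
  \bigcap_(t in [set t | (N <= t)%N]) (X t @^-1` [set x | G x.2]))//.
by apply: bigcap_measurableType => t _; exact: measurable_state.
Qed.

(** Continuity of the probability along the increasing events [always_good N],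
    whose union has probability one. *)
Lemma bad_prob_small (e : R) : (0 < e)%R ->
  exists N, Pr (~` always_good N) <= e%:E.
Proof.
move=> e0.
have mU : measurable (\bigcup_N always_good N) by exact: bigcup_measurable.
have PU : Pr (\bigcup_N always_good N) = 1.
  have [B [mB PB0 CB]] := X2_good.
  have : Pr (~` \bigcup_N always_good N) = 0.
    apply: (subset_measure0 _ mB _ PB0); first exact: measurableC.
    apply: subset_trans CB => w nU [N _ Gw]; apply: nU.
    by exists N => // t Nt; exact: Gw.
  rewrite probability_setC// -(fineK (fin_num_measure Pr _ mU)) => -[] /eqP.
  by rewrite subr_eq0 => /eqP <-.
have cA : Pr (always_good N) @[N --> \oo] --> 1%:E.
  rewrite -PU; apply: nondecreasing_cvg_mu => // m n mn.
  by apply/subsetPset => w Gw t nt; apply: Gw; exact: leq_trans nt.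
have [N _ PN] := cvge_near_ge _ _ _ cA e0.
exists N; rewrite probability_setC// leeBlDr ?fin_num_measure// addeC.
rewrite -leeBlDr// -EFinB; exact: PN (leqnn N).
Qed.

(** The error [e] is shared equally by three approximations: leaving [G] after
    [N], restricting the law of [X1 N] to a finite set [s], and stopping the
    [P]-chains started in [s] after finitely many steps. *)
Lemma liminf_marginal_ge j (e : R) : (0 < e)%R -> \forall n \near \oo,
  (pi j)%:E <= Pr [set w | (X n w).1 = j] + e%:E.
Proof.
move=> e0; have [PT [dpi _] _ Ppi] := P_ergodic.
have pi1 := is_distr_le1 _ j dpi; have pi0 := dpi.1 j.
have e3 : (0 < e / 3)%R by rewrite divr_gt0.
have [N PN] := bad_prob_small _ e3.
have [s us ss] : exists2 s : seq S1, uniq s &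
    (1 - e / 3)%:E < \sum_(i <- s) Pr [set w | (X N w).1 = i].
  apply: lt_esum_uniq_sum.
  rewrite (_ : esum _ _ = 1); first by rewrite lte_fin; lra.
  rewrite -(probability_setT Pr).
  rewrite [RHS](measure_partition Pr _ (measurable_fst_state X mX N))//.
  by apply: eq_esum => i _; rewrite setTI.
pose v := (\sum_(i <- s) fine (Pr [set w | (X N w).1 = i]))%R.
have vE : \sum_(i <- s) Pr [set w | (X N w).1 = i] = v%:E.
  rewrite /v -sumEFin; apply: eq_bigr => i _.
  by rewrite fineK// fin_num_measure//; exact: measurable_fst_state.
have cv : \sum_(i <- s) (Pr [set w | (X N w).1 = i] * nstep P n i j)
    @[n --> \oo] --> (v * pi j)%:E.
  rewrite EFinM -vE ge0_sume_distrl; last by move=> i _.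
  apply: cvg_nnesum => i _.
    by apply: nearW => n; rewrite mule_ge0// nstep_ge0.
  apply: cvgeZl; last exact: Ppi.
  by rewrite fin_num_measure//; exact: measurable_fst_state.
have [M _ hM] := cvge_near_ge _ _ _ cv e3.
exists (N + M)%N => // n /= NMn.
have Nn : (N <= n)%N by apply: leq_trans NMn; rewrite leq_addr.
have {hM} := hM (n - N)%N; rewrite /= leq_subRL// => /(_ NMn) hM.
have le_marg : \sum_(i <- s) (Pr [set w | (X N w).1 = i] * nstep P (n - N) i j)
    <= Pr [set w | (X n w).1 = j] + (e / 3)%:E.
  apply: (@le_trans _ _ (\sum_(i <- s)
      (Pr ([set w | (X n w).1 = j] `&` [set w | (X N w).1 = i]) +
       Pr (~` always_good N `&` [set w | (X N w).1 = i])))).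
    apply: lee_sum => i _.
    have := @nstep_le_marginal _ _ _ _ _ Pr p X P G mX pT X_markov PT X1_trans
      N i [set w | (X N w).1 = i] (n - N) j.
    rewrite subnKC// => /(_ _ (fun _ => id))/le_trans; apply.
      exact: (past_event_preimage X N N [set x | x.1 = i]).
    apply: leeD; first by rewrite setIC.
    apply: le_measure; rewrite ?inE.
    - apply: measurableD; first exact: measurable_fst_state.
      exact: measurable_stay.
    - apply: measurableI; last exact: measurable_fst_state.
      exact: measurableC.
    - move=> w [wi nst]; split=> // Gw; apply: nst => t /andP[Nt _].
      exact: Gw.
  rewrite big_split /=; apply: leeD.
    by apply: sum_partition_le => //; exact: measurable_fst_state.
  apply: le_trans PN; apply: sum_partition_le => //.
    exact: measurable_fst_state.
  exact: measurableC.
have mfin : Pr [set w | (X n w).1 = j] \is a fin_num.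
  by rewrite fin_num_measure//; exact: measurable_fst_state.
have := le_trans hM le_marg; move: ss; rewrite vE -(fineK mfin).
rewrite -!EFinD lte_fin !lee_fin => ss hle.
(* [v] is the mass that [s] carries at time [N]; restricting to [s] has cost
   the fraction [1 - v] of [pi j] *)
have : (pi j * (1 - v) <= e / 3)%R.
  have [v1|v1] := lerP 1 v.
    by apply: (@le_trans _ _ 0%R); [apply: mulr_ge0_le0 => //; lra|lra].
  apply: (@le_trans _ _ (1 * (1 - v))%R); last by lra.
  by apply: ler_wpM2r => //; lra.
by lra.
Qed.

Lemma marginal_l1_cvg :
  \esum_(j in [set: S1]) `| Pr [set w | (X n w).1 = j] - (pi j)%:E |
    @[n --> \oo] --> 0.
Proof.
have [_ [dpi _] _ _] := P_ergodic.
have mfin n j : Pr [set w | (X n w).1 = j] \is a fin_num.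
  by rewrite fin_num_measure//; exact: measurable_fst_state.
pose mu n j := fine (Pr [set w | (X n w).1 = j]).
rewrite (_ : (fun n => _) =
    fun n => \esum_(j in [set: S1]) `|(mu n j - pi j)%R|%:E); last first.
  apply/funext => n; apply: eq_esum => j _.
  by rewrite -(fineK (mfin n j)).
apply: scheffe => //.
- move=> n; split=> [j|]; first exact: fine_ge0.
  rewrite -(probability_setT Pr).
  rewrite [RHS](measure_partition Pr _ (measurable_fst_state X mX n))//.
  by apply: eq_esum => i _; rewrite setTI fineK.
- move=> j e e0; near=> n.
  rewrite -lee_fin EFinD fineK//; near: n; exact: liminf_marginal_ge.
Unshelve. all: end_near. Qed.

End convergence.

Lemma measurable_tuple_set1 (n : nat) (t : n.-tuple nat) : measurable [set t].
Proof.
rewrite (_ : [set t] =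
  \bigcap_(i in [set: 'I_n]) ((tnth (T:=nat)) ^~ i @^-1` [set tnth t i])).
  apply: fin_bigcap_measurable => [|i _]; first exact: finite_finset.
  rewrite -[X in measurable X]setTI.
  exact: measurable_tnth.
apply/seteqP; split=> [_ ->//|u e]; apply: eq_from_tnth => i; exact: e.
Qed.

Theorem proposition1 (R : realType) (k m : nat) (k_gt0 : (0 < k)%N)
    (m_gt0 : (0 < m)%N)
    (d : measure_display) (T : measurableType d)
    (Px : k.-tuple nat * m.-tuple nat -> probability T R)
    (p : k.-tuple nat * m.-tuple nat -> k.-tuple nat * m.-tuple nat -> R)
    (X : nat -> {mfun T >-> (k.-tuple nat * m.-tuple nat)%type})
    (X_markov : markov_family Px p X)
    (X2_dvg : forall (x : k.-tuple nat * m.-tuple nat) (i : 'I_m),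
      {ae Px x, forall w, tnth (X n w).2 i @[n --> \oo] --> \oo})
    (P : k.-tuple nat -> k.-tuple nat -> R) (pi : k.-tuple nat -> R)
    (P_ergodic : ergodic P pi)
    (X1_trans : forall (i j : k.-tuple nat) (l : m.-tuple nat),
      (forall a : 'I_m, (0 < tnth l a)%N) ->
      (\esum_(l' in [set: m.-tuple nat]) (p (i, l) (j, l'))%:E = (P i j)%:E)%E)
    (i0 : k.-tuple nat) (j0 : m.-tuple nat) :
  (ereal_sup (range (fun j : k.-tuple nat =>
     `| Px (i0, j0) [set w | (X n w).1 = j] - (pi j)%:E |))
     @[n --> \oo] --> 0)%E /\
  (\esum_(j in [set: k.-tuple nat])
     `| Px (i0, j0) [set w | (X n w).1 = j] - (pi j)%:E |
     @[n --> \oo] --> 0)%E.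
Proof.
have [pT /(_ (i0, j0))[_ mc]] := X_markov.
have mX n x : measurable [set w | X n w = x].
  have mx : measurable [set x].
    case: x => x1 x2; rewrite (_ : [set _] = [set x1] `*` [set x2]).
      by apply: measurableX; exact: measurable_tuple_set1.
    by apply/seteqP; split=> [_ ->//|[y1 y2] [/= -> ->]].
  exact: (measurable_funPTI (X n) mx).
have good : {ae Px (i0, j0), forall w, \forall t \near \oo,
    [set l : m.-tuple nat | forall a, (0 < tnth l a)%N] (X t w).2}.
  have : {ae Px (i0, j0), forall w (i : 'I_m),
      tnth (X n w).2 i @[n --> \oo] --> \oo}.
    exact: filter_forall.
  apply: filterS => w Xw; apply: filter_forall => i.
  by move/cvgnyPgt: (Xw i); exact.
have l1 := @marginal_l1_cvg _ _ _ _ _ (Px (i0, j0)) p (fun n => X n : T -> _)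
  P _ pi mX pT mc P_ergodic X1_trans good.
split=> //; apply: squeeze_cvge l1; last exact: cvg_cst.
apply: nearW => n; apply/andP; split.
  by apply: le_trans (abse_ge0 _) (ereal_sup_ubound _); exists i0.
apply: ge_ereal_sup => _ [j _ <-].
pose f j := (`|Px (i0, j0) [set w | (X n w).1 = j] - (pi j)%:E|)%E.
have := @lee_uniq_sum_esum _ _ f [:: j].
by rewrite big_seq1; apply=> // j'; exact: abse_ge0.
Qed.
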